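(* Let $G$ be an infinite group. Then $\operatorname{dsc}(G\text{-}\exp\mathcal B_G)=\operatorname{dsc}(\exp\mathcal B_G)=2^{|G|}$.
   Context: Let $(X,P,B)$ be a ballean, i.e. a set $X$ (support), a non-empty set $P$ of radii and a map $B\colon X\times P\to\mathcal P(X)$ satisfying the ballean axioms (reflexivity, symmetry, upper multiplicativity). The connected component of $x\in X$ is $\bigcup_{\alpha\in P}B(x,\alpha)$; the connected components partition $X$, and $\operatorname{dsc}$ of the ballean denotes the cardinality of the set of its connected components. For a group $G$ let $[G]^{<\omega}$ be the family of finite subsets of $G$, and let $\exp(G)$ denote the set of all non-empty subsets of $G$. The finitary ballean is $\mathcal B_G=(G,[G]^{<\omega},B_G)$ with $B_G(x,F)=\{x\}\cup Fx\cup F^{-1}x$; for $A\subseteq G$ put $B_G(A,F)=\bigcup_{y\in A}B_G(y,F)$. The hyperballean $\exp\mathcal B_G$ has support $\exp(G)$, set of radii $[G]^{<\omega}$ and balls $\exp B_G(Y,F)=\{Z\in\exp(G): Z\subseteq B_G(Y,F),\ Y\subseteq B_G(Z,F)\}$. The $G$-hyperballean $G\text{-}\exp\mathcal B_G$ has support $\exp(G)$, set of radii $[G]^{<\omega}$ and balls $G\text{-}\exp B(Y,F)=\{Y\}\cup\{gY: g\in F\}$, where $gY=\{gy:y\in Y\}$. *)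

(* Defs.v *)
From HB Require Import structures.
From mathcomp Require Import all_boot monoid finmap.
From mathcomp Require Import boolp classical_sets functions cardinality.

Set Implicit Arguments.
Unset Strict Implicit.
Unset Printing Implicit Defensive.

Import Algebra.

Local Open Scope classical_set_scope.
Local Open Scope group_scope.

(* Symmetry is required up to a change of radius, so that the asymmetric balls
   of [Gexp_ballean] below are allowed: for gY in the ball of radius F around Y,
   Y need only be in the ball of radius F^-1 around gY. *)
Record ballean := Ballean {
  support :> Type;
  radius : Type;
  ball : support -> radius -> set support;
  radius_inhabited : inhabited radius;
  ball_refl : forall x a, ball x a x;
  ball_sym : forall a, exists b, forall x y, ball x a y -> ball y b x;
  ball_mul : forall a b, exists c, forall x,
    \bigcup_(y in ball x a) ball y b `<=` ball x c
}.

Arguments ball {_} _ _.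

Definition connected_component (B : ballean) (x : B) : set B :=
  \bigcup_a ball x a.

(* dsc B is the cardinality of this set. *)
Definition connected_components (B : ballean) : set (set B) :=
  range (@connected_component B).

Arguments connected_components : clear implicits.

Definition set_ball (B : ballean) (A : set B) (a : radius B) : set B :=
  \bigcup_(y in A) ball y a.

Definition nonempty_subset (X : Type) := {Y : set X | Y !=set0}.

Section Hyperballean.
Variable B : ballean.

Definition exp_ball (Y : nonempty_subset B) (a : radius B) :
    set (nonempty_subset B) :=
  [set Z | sval Z `<=` set_ball (sval Y) a /\ sval Y `<=` set_ball (sval Z) a].

Fact exp_ball_refl Y a : exp_ball Y a Y.
Proof. by split=> y Yy; exists y => //; exact: ball_refl. Qed.

Fact exp_ball_sym a : exists b, forall Y Z, exp_ball Y a Z -> exp_ball Z b Y.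
Proof. by exists a => Y Z []. Qed.

Fact exp_ball_mul a b : exists c, forall Y,
  \bigcup_(Z in exp_ball Y a) exp_ball Z b `<=` exp_ball Y c.
Proof.
have [c1 h1] := ball_mul a b; have [c2 h2] := ball_mul b a.
have [d1 s1] := ball_sym c1; have [d2 s2] := ball_sym c2.
have [e he] := ball_mul c1 c2.
have c1e x y : ball x c1 y -> ball x e y.
  by move=> xy; apply: he; exists y => //; exact: ball_refl.
have c2e x y : ball x c2 y -> ball x e y.
  by move=> xy; apply: he; exists x => //; exact: ball_refl.
exists e => Y W [Z [ZY YZ] [WZ ZW]]; split=> [w /WZ[z /ZY[y Yy yz] zw]|].
  by exists y => //; apply: c1e; apply: h1; exists z.
move=> y /YZ[z /ZW[w Ww wz] zy].
by exists w => //; apply: c2e; apply: h2; exists z.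
Qed.

Definition exp_ballean : ballean :=
  Ballean (radius_inhabited B) exp_ball_refl exp_ball_sym exp_ball_mul.

End Hyperballean.

Section GroupBalleans.
Variable G : groupType.

Definition finitary_ball (x : G) (F : {fset G}) : set G :=
  [set x] `|` [set g * x | g in [set` F]] `|` [set g^-1 * x | g in [set` F]].

Fact fset_inhabited : inhabited {fset G}.
Proof. exact: inhabits fset0. Qed.

Fact finitary_ball_refl x F : finitary_ball x F x.
Proof. by left; left. Qed.

Fact finitary_ball_sym F :
  exists F', forall x y, finitary_ball x F y -> finitary_ball y F' x.
Proof.
exists F => x y [[->|[g Fg <-]]|[g Fg <-]].
- by left; left.
- by right; exists g; rewrite ?mulKg.
- by left; right; exists g; rewrite ?mulVKg.
Qed.

Let balanced (F : {fset G}) : {fset G} :=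
  (1 |` (F `|` [fset g^-1 | g in F]))%fset.

Let finitary_ballP x F y :
  finitary_ball x F y -> exists2 g, g \in balanced F & y = g * x.
Proof.
move=> [[->|[g Fg <-]]|[g Fg <-]].
- by exists 1; rewrite ?mul1g // !inE eqxx.
- by exists g => //; rewrite !inE (Fg : g \in F) orbT.
- exists g^-1 => //; rewrite !inE; apply/orP; right; apply/orP; right.
  by apply/imfsetP; exists g.
Qed.

Fact finitary_ball_mul F F' : exists H, forall x,
  \bigcup_(y in finitary_ball x F) finitary_ball y F' `<=` finitary_ball x H.
Proof.
exists [fset h * g | h in balanced F', g in balanced F]%fset.
move=> x z [y /finitary_ballP[g Fg ->] /finitary_ballP[h Fh ->]].
left; right; exists (h * g); last by rewrite mulgA.
by apply/imfset2P; exists h => //; exists g.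
Qed.

Definition finitary_ballean : ballean :=
  Ballean fset_inhabited finitary_ball_refl finitary_ball_sym finitary_ball_mul.

Definition translate (g : G) (Y : set G) : set G := [set g * y | y in Y].

Definition Gexp_ball (Y : nonempty_subset G) (F : {fset G}) :
    set (nonempty_subset G) :=
  [set Z | Z = Y \/ exists2 g, g \in F & sval Z = translate g (sval Y)].

Let translate1 Y : translate 1 Y = Y.
Proof.
by rewrite /translate; under eq_imagel do rewrite mul1g; rewrite image_id.
Qed.

Let translateM g h Y : translate (g * h) Y = translate g (translate h Y).
Proof.
by rewrite /translate image_comp; apply: eq_imagel => y _ /=; rewrite mulgA.
Qed.

Fact Gexp_ball_refl Y F : Gexp_ball Y F Y.
Proof. by left. Qed.

Fact Gexp_ball_sym F :
  exists F', forall Y Z, Gexp_ball Y F Z -> Gexp_ball Z F' Y.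
Proof.
exists [fset g^-1 | g in F]%fset => Y Z [->|[g Fg ZE]]; first by left.
right; exists g^-1; last by rewrite ZE -translateM mulVg translate1.
by apply/imfsetP; exists g.
Qed.

Fact Gexp_ball_mul F F' : exists H, forall Y,
  \bigcup_(Z in Gexp_ball Y F) Gexp_ball Z F' `<=` Gexp_ball Y H.
Proof.
exists (F `|` F' `|` [fset h * g | h in F', g in F])%fset.
move=> Y W [Z [->|[g Fg ZE]] [->|[h Fh WE]]].
- by left.
- by right; exists h; rewrite // !inE Fh orbT.
- by right; exists g; rewrite // !inE Fg.
right; exists (h * g); last by rewrite translateM -ZE.
by rewrite !inE; apply/orP; right; apply/imfset2P; exists h => //; exists g.
Qed.

Definition Gexp_ballean : ballean :=
  Ballean fset_inhabited Gexp_ball_refl Gexp_ball_sym Gexp_ball_mul.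

End GroupBalleans.

(* Main.v *)
Require Import Defs.
From mathcomp Require Import all_boot monoid finmap.
From mathcomp Require Import boolp classical_sets functions cardinality.
From mathcomp Require Import wochoice.
From Stdlib Require Import Wellfounded.

(** The proof squeezes the two cardinals between equal bounds.

    Above: if Z = gY with g in F, then Z lies in the ball of radius F around Y
    in the hyperballean, so every component of the hyperballean is a union of
    components of the G-hyperballean; the latter has no more components than
    points, hence at most 2^|G|
    ([connected_components_exp_le_Gexp], [connected_components_Gexp_le]).

    Below: 2^|G| pairwise distant subsets are needed. Index points
    y_(l, F) of G by labels l in G x Prop and finite subsets F of G, so that
    y_p is never in the ball of radius F around y_q when p = (l, F) <> q
    ([separated_family]). For S a subset of G let Y_S consist of the y_(l, F)
    whose label l = (i, P) satisfies P = S(i). If S and S' differ at i and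
    Y_S, Y_S' were in one component, at radius F say, then the point
    y_((i, S(i)), F) of Y_S would be in the ball of radius F around a point of
    Y_S', which carries another label: contradiction
    ([connected_components_exp_ge]). Remembering the truth value in the label
    makes every Y_S nonempty and the argument symmetric in S and S'.

    The points y_p are chosen one after the other along a well-order of the
    indices in which every proper initial segment has fewer than |G| elements
    ([initial_well_order], [wf_greedy]). At each step the forbidden points form
    a union of finite sets indexed by an initial segment, which cannot be all
    of G ([card_le_bigcup_countable]). This and |G x Prop x [G]^<w| = |G| rest
    on the theorem that A x A has the cardinality of A for infinite A
    ([infinite_setX_card_le]), which is obtained by the same greedy choice. *)

Set Implicit Arguments.
Unset Strict Implicit.
Unset Printing Implicit Defensive.

Local Open Scope classical_set_scope.
Local Open Scope card_scope.

(** * Well-orders and greedy choice *)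

Definition strict_well_order (X : Type) (lt : X -> X -> Prop) :=
  well_founded lt /\ forall x y, x <> y -> lt x y \/ lt y x.

Definition segment (X : Type) (lt : X -> X -> Prop) (x : X) : set X :=
  [set y | lt y x].

Lemma wf_irrefl (X : Type) (lt : X -> X -> Prop) (wf : well_founded lt) x :
  ~ lt x x.
Proof. by elim/(well_founded_ind wf): x => x IH xx; exact: (IH x xx xx). Qed.

(** A failure of transitivity would be a cycle of length two or three, which
    induction on its first element rules out. *)
Lemma strict_well_order_trans (X : Type) (lt : X -> X -> Prop) :
  strict_well_order lt -> forall x y z, lt x y -> lt y z -> lt x z.
Proof.
move=> [wf tri] x; elim/(well_founded_ind wf): x => x IH y z xy yz.
have [xz|/tri[//|zx]] := pselect (x = z).
  by subst z; case: (wf_irrefl wf (IH y yz x y yz xy)).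
by case: (wf_irrefl wf (IH z zx y z (IH z zx x y zx xy) yz)).
Qed.

Lemma strict_well_order_exists (X : Type) :
  exists lt : X -> X -> Prop, strict_well_order lt.
Proof.
elim/Peq: X => X; have [R woR] := well_ordering_principle X.
have Rwo : wo_chain R predT by apply: withinW.
have Rtot x y : R x y || R y x by apply: (wo_chainW Rwo).
have Ranti x y : R x y -> R y x -> x = y.
  by move=> xy yx; apply: (wo_chain_antisymmetric Rwo) => //; rewrite xy.
exists (fun x y => ~~ R y x); split=> [x|x y nxy]; last first.
  have [Rxy|] := boolP (R x y); last by right.
  by left; apply/negP => /(Ranti _ _ Rxy).
apply: contrapT => nax.
have [|z [[zN minz] _]] := woR [pred y | `[< ~ Acc (fun x y => ~~ R y x) y >]].
  by exists x; apply/asboolP.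
have /asboolP := zN; apply; constructor => y yz; apply: contrapT => ny.
by move/negP: yz; apply; apply: minz; apply/asboolP.
Qed.

Lemma wf_pick_minimal (X : Type) (lt : X -> X -> Prop) (P : X -> Prop) :
  well_founded lt -> (exists x, P x) ->
  exists2 x, P x & forall y, lt y x -> ~ P y.
Proof.
move=> wf [x]; elim/(well_founded_ind wf): x => x IH Px.
have [[y yx Py]|n] := pselect (exists2 y, lt y x & P y); first exact: IH Py.
by exists x => // y yx Py; apply: n; exists y.
Qed.

Lemma card_le_inj (T U : Type) (A : set T) (B : set U) (f : T -> U) :
  set_fun A B f -> set_inj A f -> A #<= B.
Proof.
move=> fAB fi; have /injfunPex[g] : exists2 f, set_fun A B f & set_inj A f.
  by exists f.
exact: inj_card_le g.
Qed.

Lemma card_le_inj_ex (T U : Type) (A : set T) (B : set U) :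
  B !=set0 -> A #<= B -> exists2 f : T -> U, set_fun A B f & set_inj A f.
Proof.
elim/Ppointed: U => U in B *; first by rewrite emptyE => -[].
by move=> _ /pcard_leP/injfunPex.
Qed.

(** The order type is made an initial ordinal: in any well-order of X, take the
    first segment into which X embeds, if there is one, and pull the order back
    along such an embedding. *)
Lemma initial_well_order (X : Type) :
  exists2 lt : X -> X -> Prop, strict_well_order lt &
    forall x, ~ ([set: X] #<= segment lt x).
Proof.
have [lt [wf tri]] := strict_well_order_exists X.
have [|n] := pselect (exists a, [set: X] #<= segment lt a); last first.
  by exists lt => // x le; apply: n; exists x.
move=> /(wf_pick_minimal wf)[a lea mina].
have ne : segment lt a !=set0.
  apply/set0P/eqP => E; move: lea.
  by rewrite E card_le0 => /eqP/seteqP[/(_ a I)].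
have [f fa finj] := card_le_inj_ex ne lea.
exists (fun x y => lt (f x) (f y)).
  split; first exact: wf_inverse_image.
  move=> x y nxy; apply: tri => fxy; apply: nxy.
  by apply: finj; rewrite ?inE.
move=> x le; apply: (mina (f x)); first exact: fa.
apply: (card_le_trans le); apply: (@card_le_inj _ _ _ _ f) => //.
by move=> y z _ _; apply: finj; rewrite ?inE.
Qed.

(** If a value for p can always be found that is compatible with whatever values
    were given below p, then well-founded recursion gives a function whose
    values are pairwise compatible. Total functions h replace the partial
    assignments below p, to spare their users a dependent type; v0 fills the
    places not yet assigned. *)
Lemma wf_greedy (P V : Type) (lt : P -> P -> Prop)
    (R : P -> P -> V -> V -> Prop) (v0 : V) :
    well_founded lt ->
    (forall p (h : P -> V), exists v, forall q, lt q p -> R q p (h q) v) ->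
  exists f : P -> V, forall q p, lt q p -> R q p (f q) (f p).
Proof.
move=> wf step.
have /choice[c cP] (ph : P * (P -> V)) :
  exists v, forall q, lt q ph.1 -> R q ph.1 (ph.2 q) v by exact: step.
pose ext p (h : forall q, lt q p -> V) q :=
  if pselect (lt q p) is left qp then h q qp else v0.
pose F p h := c (p, ext p h).
exists (Fix wf (fun=> V) F) => q p qp.
have FE :
    forall x, Fix wf (fun=> V) F x = F x (fun y _ => Fix wf (fun=> V) F y).
  apply: Fix_eq => x f g fg; congr (c (x, _)); apply/funext => y.
  by rewrite /ext; case: pselect.
rewrite (FE p); set g := fun y _ => Fix wf (fun=> V) F y.
have /= := cP (p, ext p g) q qp.
suff -> : ext p g q = Fix wf (fun=> V) F q by [].
by rewrite /ext; case: pselect.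
Qed.

(** * The square of an infinite cardinal *)

Lemma card_le_setX (T T' U U' : Type) (A : set T) (A' : set T') (B : set U)
    (B' : set U') : A #<= B -> A' #<= B' -> A `*` A' #<= B `*` B'.
Proof.
elim/Ppointed: U => U in B *.
  by rewrite !emptyE_subdef => -> _; rewrite set0X card_ge0.
elim/Ppointed: U' => U' in B' *.
  by rewrite !emptyE_subdef => _ ->; rewrite setX0 card_ge0.
move=> /pcard_leP/injfunPex[f fA fi] /pcard_leP/injfunPex[g gA gi].
apply: (@card_le_inj _ _ _ _ (fun x => (f x.1, g x.2))).
  by move=> [x y] [/= Ax Ay]; split=> /=; [exact: fA | exact: gA].
move=> [x y] [x' y']; rewrite !inE => -[/= Ax Ay] [/= Ax' Ay'] [/fi Ex /gi Ey].
by congr (_, _); [apply: Ex | apply: Ey]; rewrite inE.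
Qed.

Lemma idem_card_eq (T U : Type) (A : set T) (B : set U) :
  A #= B -> B `*` B #<= B -> A `*` A #<= A.
Proof.
move=> /card_eqPle[AB BA] BB.
exact: card_le_trans (card_le_setX AB AB) (card_le_trans BB BA).
Qed.

(** The extra point is sent to a pair (a, b) off the copy of A formed by the
    pairs (y, a). *)
Lemma idem_setU1 (T : Type) (A : set T) (x : T) :
  infinite_set A -> A `*` A #<= A -> A `|` [set x] #<= A.
Proof.
move=> Ainf AA; apply: card_le_trans AA.
have [a Aa] := infinite_setN0 Ainf.
have [b [Ab ab]] : exists b, A b /\ b <> a.
  apply: contrapT => n; apply: Ainf.
  apply: (@sub_finite_set _ _ [set a]) => // b Ab.
  by apply: contrapT => ba; apply: n; exists b.
pose f y := if pselect (y = x) then (a, b) else (y, a).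
apply: (@card_le_inj _ _ _ _ f); rewrite /f.
  by move=> y; case: pselect => /= [yx _|nyx [|/nyx]].
move=> y z _ _; case: pselect => yx; case: pselect => zx /=.
- by rewrite yx zx.
- by move=> [_ /ab].
- by move=> [_ /esym/ab].
- by move=> [].
Qed.

Section Hessenberg.
Variables (X : Type) (lt : X -> X -> Prop).
Hypothesis lt_swo : strict_well_order lt.

Let wf : well_founded lt := lt_swo.1.
Let tri := lt_swo.2.
Let lt_trans := strict_well_order_trans lt_swo.

Let max (p : X * X) := if pselect (lt p.1 p.2) then p.2 else p.1.

Let max_le1 p : lt p.1 (max p) \/ p.1 = max p.
Proof. by rewrite /max; case: pselect; [left | right]. Qed.

Let max_le2 p : lt p.2 (max p) \/ p.2 = max p.
Proof.
rewrite /max; case: pselect => /= [_|n12]; first by right.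
have [->|/tri[]//] := pselect (p.2 = p.1); [by right | by left].
Qed.

(** Goedel's well-order of pairs: compare the maxima first, so that the pairs
    below p lie in the square of an initial segment of X. An arbitrary
    well-order of X x X breaks ties. *)
Lemma wf_max (lt2 : X * X -> X * X -> Prop) : well_founded lt2 ->
  well_founded (fun q p => lt (max q) (max p) \/ max q = max p /\ lt2 q p).
Proof.
move=> wf2 p; move mE : (max p) => m.
elim/(well_founded_ind wf): m p mE => m IHm p.
elim/(well_founded_ind wf2): p => p IHp mE; constructor => q [|[qp q2]].
  by rewrite mE => qm; exact: IHm qm _ erefl.
by apply: IHp => //; rewrite qp.
Qed.

(** When A is larger than its initial segments, pairs of A are injected into A
    one at a time along the order of [wf_max]: the values already used at stage
    p are no more than C x C for a proper closed segment C of A, hence fewer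
    than A. *)
Lemma idem_initial (A : set X) :
    (forall x y, A y -> lt x y -> A x) -> infinite_set A ->
    (forall x, A x -> infinite_set (segment lt x) ->
      segment lt x `*` segment lt x #<= segment lt x) ->
    (forall x, A x -> ~ (A #<= segment lt x)) ->
  A `*` A #<= A.
Proof.
move=> Adown Ainf segidem Ainit.
have [a0 Aa0] := infinite_setN0 Ainf.
have [lt2 [wf2 tri2]] := strict_well_order_exists (X * X).
pose ltm q p := lt (max q) (max p) \/ max q = max p /\ lt2 q p.
have wfm : well_founded ltm by exact: wf_max.
have trim p q : p <> q -> ltm p q \/ ltm q p.
  move=> npq; have [e|/tri[]] := pselect (max p = max q).
  - by case: (tri2 _ _ npq) => ?; [left|right]; right.
  - by left; left.
  - by right; left.
pose V : Type := set_type A.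
have [|f fP] := @wf_greedy _ V ltm
    (fun q p u v => (A `*` A) p -> (A `*` A) q -> u <> v)
    (SigSub (mem_set Aa0)) wfm.
  move=> p h; have [AAp|nAAp] := pselect ((A `*` A) p); last first.
    by exists (SigSub (mem_set Aa0)).
  apply: contrapT => nv.
  (* If no value is left for p, then h maps D onto A. *)
  pose D := [set q | ltm q p /\ (A `*` A) q].
  have VD : A #<= D.
    apply: (@card_le_trans _ _ _ [set: V]).
      by rewrite (card_le_eqr (card_setT _)).
    apply: (@card_le_trans _ _ _ (h @` D)); last exact: card_image_le.
    apply: subset_card_le => v _; apply: contrapT => nhv; apply: nv.
    by exists v => q qp _ AAq hq; apply: nhv; exists q.
  have Am : A (max p) by rewrite /max; case: AAp => ? ?; case: pselect.
  pose C := segment lt (max p) `|` [set max p].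
  have DC : D `<=` C `*` C.
    move=> q [qp _]; have le x : lt x (max q) \/ x = max q -> C x.
      case: qp => [qp [xq|->]|[-> _]//]; left => //.
      exact: lt_trans qp.
    by split; apply: le; [exact: max_le1 | exact: max_le2].
  have ACC := card_le_trans VD (subset_card_le DC).
  have [sfin|sinf] := pselect (finite_set (segment lt (max p))).
    apply: Ainf; apply: card_le_finite ACC _.
    by apply: finite_setX; rewrite finite_setU; split.
  have ss := segidem _ Am sinf; have Cs := idem_setU1 (max p) sinf ss.
  apply: (Ainit _ Am); apply: (card_le_trans ACC).
  exact: card_le_trans (card_le_setX Cs Cs) ss.
apply: (@card_le_inj _ _ _ _ (fun p => val (f p))).
  by move=> p _; apply: set_mem; exact: valP.
move=> p q; rewrite !inE => AAp AAq /val_inj fpq.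
apply: contrapT => /trim[pq|qp].
  exact: fP pq AAq AAp fpq.
exact: fP qp AAp AAq (esym fpq).
Qed.

(** Either A is equinumerous with one of its segments, which satisfies the
    conclusion, or [idem_initial] applies. *)
Lemma idem_downward_closed (A : set X) :
    (forall x y, A y -> lt x y -> A x) -> infinite_set A ->
    (forall x, A x -> infinite_set (segment lt x) ->
      segment lt x `*` segment lt x #<= segment lt x) ->
  A `*` A #<= A.
Proof.
move=> Adown Ainf segidem.
have [[x Ax As]|n] := pselect (exists2 x, A x & A #<= segment lt x); last first.
  by apply: idem_initial => // x Ax As; apply: n; exists x.
have sA : segment lt x #<= A by apply: subset_card_le => y; exact: Adown.
apply: (@idem_card_eq _ _ _ (segment lt x)); first by rewrite card_eq_le As.
by apply: segidem => // sfin; apply: Ainf; exact: card_le_finite As sfin.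
Qed.

Lemma idem_segment x : infinite_set (segment lt x) ->
  segment lt x `*` segment lt x #<= segment lt x.
Proof.
elim/(well_founded_ind wf): x => x IH xinf.
by apply: idem_downward_closed => // y z zx yz; exact: lt_trans zx.
Qed.

End Hessenberg.

(** Hessenberg's theorem. *)
Theorem infinite_setX_card_le (T : Type) (A : set T) :
  infinite_set A -> A `*` A #<= A.
Proof.
move=> Ainf; have [lt ltP] := strict_well_order_exists (set_type A).
apply: (idem_card_eq (card_setT_sym A)).
apply: (idem_downward_closed ltP) => // [|x _]; last exact: idem_segment.
by rewrite (eq_finite_set (card_setT _)).
Qed.

Lemma infinite_card_le_setX (T U V : Type) (A : set T) (B : set U) (C : set V) :
  infinite_set C -> A #<= C -> B #<= C -> A `*` B #<= C.
Proof.
move=> Cinf AC BC.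
exact: card_le_trans (card_le_setX AC BC) (infinite_setX_card_le Cinf).
Qed.

(** A point of the union is coded by an index i of a set F i that contains it
    and its number in an enumeration of F i, so the union embeds in
    D x nat. *)
Lemma card_le_bigcup_countable (I T : Type) (D : set I) (F : I -> set T) :
    infinite_set D -> (forall i, D i -> countable (F i)) ->
  \bigcup_(i in D) F i #<= D.
Proof.
move=> Dinf Fc; have [i0 _] := infinite_setN0 Dinf.
have /choice[e eP] i : exists e : T -> nat, D i -> {in F i &, injective e}.
  have [Di|nDi] := pselect (D i); last by exists (fun=> 0%N).
  by have /countable_injP[e ei] := Fc i Di; exists e.
have /choice[ix ixP] x :
    exists i, (\bigcup_(i in D) F i) x -> D i /\ F i x.
  have [[i Di Fx]|n] := pselect ((\bigcup_(i in D) F i) x); last by exists i0.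
  by exists i.
apply: (@card_le_trans _ _ _ (D `*` [set: nat])); last first.
  by apply: infinite_card_le_setX => //; exact/infiniteP.
apply: (@card_le_inj _ _ _ _ (fun x => (ix x, e (ix x) x))).
  by move=> x /ixP[].
move=> x y; rewrite !inE => /ixP[Dx Fx] /ixP[Dy Fy] [xy].
by rewrite -xy in Fy *; apply: eP; rewrite // inE.
Qed.

(** A sequence is coded by its length and its iterated pairing; the length is
    what makes the decoding unambiguous. *)
Lemma infinite_card_le_seq (T : Type) :
  infinite_set [set: T] -> [set: seq T] #<= [set: T].
Proof.
move=> Tinf; have T0 := infinite_setN0 Tinf; have [t0 _] := T0.
have injT (U : Type) (f : U -> T) : set_inj [set: U] f -> injective f.
  by move=> fi x y; apply: fi; rewrite inE.
have [|h _ /injT hi] := @card_le_inj_ex _ _ [set: T * T] _ T0.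
  by rewrite -setXTT; exact: infinite_setX_card_le.
have [e _ /injT ei] := card_le_inj_ex T0 ((infiniteP _).1 Tinf).
pose code (s : seq T) := foldr (fun x y => h (x, y)) t0 s.
apply: (@card_le_inj _ _ _ _ (fun s => h (e (size s), code s))) => //.
move=> s s' _ _ /hi[/ei].
elim: s s' => [|x s IH] [|x' s'] //= [ss].
by move=> /hi[-> /(IH _ ss) ->].
Qed.

Lemma infinite_card_le_fset (T : choiceType) :
  infinite_set [set: T] -> [set: {fset T}] #<= [set: T].
Proof.
move=> /infinite_card_le_seq; apply: card_le_trans.
apply: (@card_le_inj _ _ _ _ (fun F : {fset T} => enum_fset F)) => //.
move=> F F' _ _ FF'; apply/fsetP => x.
by rewrite -[LHS]/(x \in enum_fset F) FF'.
Qed.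

(** * Components of balleans *)

Lemma connected_component_refl (B : ballean) (x : B) : connected_component x x.
Proof. by have [a] := radius_inhabited B; exists a => //; exact: ball_refl. Qed.

Lemma connected_component_eq (B : ballean) (x y : B) :
  connected_component x y -> connected_component x = connected_component y.
Proof.
move=> [a _ xy]; have [a' sym] := ball_sym a; have yx := sym _ _ xy.
apply/seteqP; split=> z [b _ bz].
  by have [c cP] := ball_mul a' b; exists c => //; apply: cP; exists x.
by have [c cP] := ball_mul a b; exists c => //; apply: cP; exists y.
Qed.

(** * The two hyperballeans of a group *)

Section GroupHyperballeans.
Variable G : groupType.
Implicit Types (x y g : G) (F : {fset G}) (Y Z : nonempty_subset G).

Let expB := exp_ballean (finitary_ballean G).

Lemma finitary_ballC x y F : finitary_ball x F y -> finitary_ball y F x.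
Proof.
move=> [[->|[g Fg <-]]|[g Fg <-]]; first by left; left.
  by right; exists g; rewrite ?mulKg.
by left; right; exists g; rewrite ?mulVKg.
Qed.

Lemma finite_finitary_ball x F : finite_set (finitary_ball x F).
Proof.
have fF := finite_fset F.
rewrite !finite_setU; split; first split.
- exact: finite_set1.
- exact: finite_image.
- exact: finite_image.
Qed.

Lemma Gexp_ball_sub Y F : Gexp_ball Y F `<=` @ball expB Y F.
Proof.
move=> Z [->|[g Fg ZE]]; first exact: ball_refl.
split=> [z|y Yy]; rewrite ZE.
  by move=> [y Yy <-]; exists y => //; left; right; exists g.
by exists (g * y)%g; [exists y | right; exists g; rewrite ?mulKg].
Qed.

(** The components of [expB] are the images of those of the G-hyperballean
    under saturation. *)
Lemma connected_components_exp_le_Gexp :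
  connected_components expB #<= connected_components (Gexp_ballean G).
Proof.
pose coarsen (C : set (nonempty_subset G)) :=
  \bigcup_(Z in C) @connected_component expB Z.
apply: card_le_trans (card_image_le coarsen _); apply: subset_card_le.
move=> _ [Y _ <-].
exists (@connected_component (Gexp_ballean G) Y); first by exists Y.
apply/seteqP; split=> [W [Z [F _ FZ] ZW]|W YW].
  suff -> : @connected_component expB Y = @connected_component expB Z by [].
  by apply: connected_component_eq; exists F => //; exact: Gexp_ball_sub.
by exists Y => //; exact: connected_component_refl.
Qed.

Lemma connected_components_Gexp_le :
  connected_components (Gexp_ballean G) #<= [set: set G].
Proof.
apply: (card_le_trans (card_image_le _ _)).
apply: (@card_le_inj _ _ _ _ (fun Y => sval Y)) => //.
by move=> [Y Y0] [Z Z0] _ _ /= YZ; exact: eq_exist.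
Qed.

(** Each new point y_p is kept out of the balls of radii p.2 and q.2 around every
    earlier y_q. The first is the claim for the pair (p, q); by symmetry of
    balls, the second is the claim for (q, p). *)
Lemma separated_family (L : Type) :
    infinite_set [set: G] -> [set: L] #<= [set: G] ->
  exists y : L * {fset G} -> G, forall p q,
    p <> q -> ~ finitary_ball (y q) p.2 (y p).
Proof.
move=> Ginf LG.
have PG : [set: L * {fset G}] #<= [set: G].
  rewrite -setXTT; apply: infinite_card_le_setX => //.
  exact: infinite_card_le_fset.
have [lt [wf tri] init] := initial_well_order (L * {fset G}).
have [|y yP] := @wf_greedy _ G lt (fun q p u v =>
    ~ finitary_ball u p.2 v /\ ~ finitary_ball u q.2 v) 1%g wf.
  move=> p h; apply: contrapT => nv.
  pose bad q := finitary_ball (h q) p.2 `|` finitary_ball (h q) q.2.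
  have badT : [set: G] `<=` \bigcup_(q in segment lt p) bad q.
    move=> v _; apply: contrapT => nb; apply: nv; exists v => q qp.
    by split=> hv; apply: nb; exists q => //; [left | right].
  have badfin q : finite_set (bad q).
    by rewrite finite_setU; split; exact: finite_finitary_ball.
  have [sfin|sinf] := pselect (finite_set (segment lt p)).
    apply: Ginf; apply: sub_finite_set badT _.
    exact: bigcup_finite.
  apply: (init p); apply: (card_le_trans PG).
  apply: (card_le_trans (subset_card_le badT)).
  by apply: card_le_bigcup_countable => // q _; exact: finite_set_countable.
exists y => p q /tri[pq|qp]; last by have [] := yP _ _ qp.
by have [_ n] := yP _ _ pq => /finitary_ballC.
Qed.

(** The subset fam S has, for each i and each radius F, a point indexed by F
    and labelled (i, S i): it is the witness that radius F does not bring fam S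
    close to fam S' when S and S' differ at i. *)
Lemma connected_components_exp_ge : infinite_set [set: G] ->
  [set: set G] #<= connected_components expB.
Proof.
move=> Ginf.
have [|y yP] := @separated_family (G * Prop) Ginf.
  rewrite -setXTT; apply: infinite_card_le_setX => //.
  have /card_le_trans : [set: Prop] #<= [set: nat].
    apply: (@card_le_inj _ _ _ _ (fun P : Prop => `[< P >] : nat)) => //.
    move=> P Q _ _; case: asboolP => p; case: asboolP => q // _.
      exact/propext.
    exact/propext.
  by apply; exact/infiniteP.
pose fam (S : set G) := [set y p | p in [set p | p.1.2 = S p.1.1]].
have fam0 S : fam S !=set0.
  by exists (y (1%g, S 1%g, fset0)); exists (1%g, S 1%g, fset0).
pose famE S : expB := exist _ (fam S) (fam0 S).
apply: (@card_le_inj _ _ _ _ (fun S => @connected_component expB (famE S))).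
  by move=> S _; exists (famE S).
move=> S S' _ _ SS'; apply/funext => i; apply: contrapT => neq.
have : @connected_component expB (famE S) (famE S').
  by rewrite SS'; exact: connected_component_refl.
move=> [F _ [_ /(_ (y (i, S i, F)))[]]]; first by exists (i, S i, F).
move=> _ [q qS' <-]; apply: yP => qE; apply: neq.
by move: qS'; rewrite -qE.
Qed.

End GroupHyperballeans.

Theorem proposition3p34 (G : groupType) (infG : infinite_set [set: G]) :
  connected_components (Gexp_ballean G)
    #= connected_components (exp_ballean (finitary_ballean G)) /\
  connected_components (exp_ballean (finitary_ballean G)) #= [set: set G].
Proof.
have expG := connected_components_exp_le_Gexp G.
have Gset := connected_components_Gexp_le G.
have setexp := connected_components_exp_ge infG.
rewrite !card_eq_le expG setexp (card_le_trans Gset setexp).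
by rewrite (card_le_trans expG Gset).
Qed.
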